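(* Let $\mathcal P$ be an operad over a field $\Bbbk$ of characteristic zero, generated by binary operations. For a $\mathcal P$-algebra $A$ with a strictly positive weight grading $A=\bigoplus_{n>0}A_n$, let $\mathcal F(A)$ be the vector space $A$ equipped with the operations \[ \omega_\prec(a_1,a_2)=\frac{|a_1|}{|a_1|+|a_2|}\,\omega(a_1,a_2),\qquad \omega_\succ(a_1,a_2)=\frac{|a_2|}{|a_1|+|a_2|}\,\omega(a_1,a_2) \] for each generator $\omega$ of $\mathcal P$ and all weight-homogeneous $a_1,a_2\in A$, where $|a|$ denotes the weight of $a$. Then $\mathcal F$ is a functor from the category of $\mathcal P$-algebras with a strictly positive weight grading to the category of $\mathrm{DSu}(\mathcal P)$-algebras; in particular, the operations $\omega_\prec,\omega_\succ$ make $A$ into a $\mathrm{DSu}(\mathcal P)$-algebra.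
   Context: A weight grading on a $\mathcal P$-algebra is one respected by the structure operations, $\omega(A_i,A_j)\subseteq A_{i+j}$ for every generator $\omega$; morphisms of weight graded algebras preserve the grading. Disuccessor. Let $\mathcal P=\mathcal T(V)/(\mathcal R)$ be presented by binary generators $V$ (an $S_2$-module) and a space of relations $\mathcal R$ in the free operad $\mathcal T(V)$. The operad $\mathrm{DSu}(\mathcal P)$ has binary generators $\omega_\prec,\omega_\succ$ (linear in $\omega\in V$), with $S_2$-action determined by $(\omega_\prec)^{(12)}=(\omega^{(12)})_\succ$, $(\omega_\succ)^{(12)}=(\omega^{(12)})_\prec$. Given a binary tree monomial $\tau$ (planar binary tree with vertices labelled by elements of $V$ and leaves labelled bijectively by $1,\dots,n$) and a leaf $x$, let $\mathrm{Su}_x(\tau)$ be obtained by replacing the label $\omega$ of each vertex by: $\omega_\prec$ if the vertex lies on the path from the root to $x$ and the path turns left (to the first input) there; $\omega_\succ$ if it lies on the path and the path turns right (to the second input) there; and $\omega_\prec+\omega_\succ$ if the vertex is not on the path. Extend $\mathrm{Su}_x$ linearly. The relations of $\mathrm{DSu}(\mathcal P)$ are $\mathrm{Su}_x(r)$ for all $r\in\mathcal R$ of arity $n$ and all $x\in\{1,\dots,n\}$. For example, $\mathrm{DSu}$ of the associative operad is the dendriform operad, $\mathrm{DSu}(\mathrm{Lie})$ is the pre-Lie operad, and $\mathrm{DSu}(\mathrm{Com})$ is the Zinbiel operad. *)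

(* Defs.v *)
From HB Require Import structures.
From mathcomp Require Import all_boot all_order all_algebra.
From Stdlib Require Import ProofIrrelevance.

Set Implicit Arguments.
Unset Strict Implicit.
Unset Printing Implicit Defensive.

Import GRing.Theory.
Local Open Scope ring_scope.

(** * Tree monomials and the free operad on binary generators *)

(* Planar binary trees with vertices labelled by [V] and leaves by [I]. *)
Inductive tree (V I : Type) : Type :=
| Leaf of I
| Node of V & tree V I & tree V I.
Arguments Leaf {V I} _.
Arguments Node {V I} _ _ _.

Fixpoint leaves (V I : Type) (t : tree V I) : seq I :=
  match t with
  | Leaf i => [:: i]
  | Node _ l r => leaves l ++ leaves r
  end.

(* The leaves are labelled bijectively by 'I_n (the set {1, ..., n}, shifted
   to start at 0). *)
Definition tree_monomial (V : Type) (n : nat) (t : tree V 'I_n) : bool :=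
  perm_eq (leaves t) (enum 'I_n).

(* A finite sum c_1 t_1 + ... + c_m t_m, as the list of its terms (c_i, t_i).
   The component T(V)(n) of the free operad is the set of these sums of tree
   monomials modulo linearity in each vertex label and the identification of
   the vertex w^(12)(l, r) with w(r, l); an element of T(V)(n) is written here
   through any of its representatives. *)
Definition tree_sum (k : fieldType) (V : Type) (n : nat) : Type :=
  seq (k * tree V 'I_n).

(* Value of a tree, and of a sum of trees, on [a] when each vertex labelled [w]
   is interpreted by the operation [op w]. *)
Fixpoint eval_tree (V I A : Type) (op : V -> A -> A -> A) (a : I -> A)
    (t : tree V I) : A :=
  match t with
  | Leaf i => a i
  | Node w l r => op w (eval_tree op a l) (eval_tree op a r)
  end.

Definition eval_sum (k : fieldType) (V : Type) (A : lmodType k) (n : nat)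
    (op : V -> A -> A -> A) (a : 'I_n -> A) (r : tree_sum k V n) : A :=
  \sum_(ct <- r) ct.1 *: eval_tree op a ct.2.

(** * Operads presented by binary generators and relations *)

(* The operad T(V)/(R), given by its presentation: [gen] is the S_2-module V,
   [swap] the action of (12) on it.  [rel n] is any set of elements of T(V)(n),
   a subspace or a spanning set of one, since (R) is the ideal it generates;
   the relations Su_x(r) below are only a spanning set. *)
Record presentation (k : fieldType) : Type := Presentation {
  gen : lmodType k;
  swap : gen -> gen;
  swap_linear : linear swap;
  swap_involutive : involutive swap;
  rel : forall n : nat, tree_sum k gen n -> Prop;
  rel_monomial : forall (n : nat) (r : tree_sum k gen n), rel r ->
    all (fun ct => tree_monomial ct.2) r
}.

(** * The disuccessor *)

Section Disuccessor.
Variables (k : fieldType) (P : presentation k).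

(* The generators of DSu(P) form the direct sum of two copies of V: the pair
   (v, w) stands for v_< + w_>. *)
Definition dsu_gen : lmodType k := (gen P * gen P)%type.

Definition prec (w : gen P) : dsu_gen := (w, 0).
Definition succ (w : gen P) : dsu_gen := (0, w).

Definition dsu_swap (p : dsu_gen) : dsu_gen :=
  prec (swap p.2) + succ (swap p.1).

(* Su_x; the path from the root to [x] goes through a vertex exactly when [x]
   is a leaf below it. *)
Fixpoint Su (n : nat) (x : 'I_n) (t : tree (gen P) 'I_n) :
    tree dsu_gen 'I_n :=
  match t with
  | Leaf i => Leaf i
  | Node w l r =>
      Node (if x \in leaves l then prec w
            else if x \in leaves r then succ w
            else prec w + succ w)
           (Su x l) (Su x r)
  end.

Definition Su_sum (n : nat) (x : 'I_n) (r : tree_sum k (gen P) n) :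
    tree_sum k dsu_gen n :=
  [seq (ct.1, Su x ct.2) | ct <- r].

Definition dsu_rel (n : nat) (s : tree_sum k dsu_gen n) : Prop :=
  exists (r : tree_sum k (gen P) n) (x : 'I_n), rel r /\ s = Su_sum x r.

Lemma dsu_swapE (p : dsu_gen) : dsu_swap p = (swap p.2, swap p.1).
Proof. by congr pair; rewrite /= ?addr0 ?add0r. Qed.

Lemma dsu_swap_linear : linear dsu_swap.
Proof.
by move=> c u v; rewrite !dsu_swapE; congr pair; rewrite /= swap_linear.
Qed.

Lemma dsu_swap_involutive : involutive dsu_swap.
Proof. by case=> u v; rewrite !dsu_swapE /= !swap_involutive. Qed.

Lemma leaves_Su (n : nat) (x : 'I_n) (t : tree (gen P) 'I_n) :
  leaves (Su x t) = leaves t.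
Proof. by elim: t => //= w l -> r ->. Qed.

Lemma dsu_rel_monomial (n : nat) (s : tree_sum k dsu_gen n) :
  dsu_rel s -> all (fun ct => tree_monomial ct.2) s.
Proof.
case=> r [x [/rel_monomial rP ->]]; rewrite all_map.
by apply: sub_all rP => ct; rewrite /tree_monomial /= leaves_Su.
Qed.

Definition DSu : presentation k :=
  @Presentation k dsu_gen dsu_swap dsu_swap_linear dsu_swap_involutive
    dsu_rel dsu_rel_monomial.

End Disuccessor.

(** * Algebras *)

(* [op] extends to a morphism of operads from T(V)/(R) to the endomorphism
   operad of A: it is a map of S_2-modules from V to bilinear operations on A
   which kills the relations. *)
Record is_algebra (k : fieldType) (P : presentation k) (A : lmodType k)
    (op : gen P -> A -> A -> A) : Prop := IsAlgebra {
  op_linear_gen : forall a b : A, linear (fun w => op w a b);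
  op_linear_l : forall (w : gen P) (b : A), linear (fun a => op w a b);
  op_linear_r : forall (w : gen P) (a : A), linear (op w a);
  op_swap : forall (w : gen P) (a b : A), op (swap w) a b = op w b a;
  op_rel : forall (n : nat) (r : tree_sum k (gen P) n), rel r ->
    forall a : 'I_n -> A, eval_sum op a r = 0
}.

Record algebra (k : fieldType) (P : presentation k) : Type := Algebra {
  carrier :> lmodType k;
  alg_op : gen P -> carrier -> carrier -> carrier;
  algP : is_algebra alg_op
}.

Record alg_hom (k : fieldType) (P : presentation k) (A B : algebra P) : Type :=
  AlgHom {
    hom_fun :> A -> B;
    hom_linear : linear hom_fun;
    hom_op : forall (w : gen P) (a b : A),
      hom_fun (alg_op w a b) = alg_op w (hom_fun a) (hom_fun b)
  }.

(* A is the internal direct sum of the subspaces W n for n > 0. *)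
Record positive_grading (k : fieldType) (A : lmodType k)
    (W : nat -> A -> Prop) : Prop := PositiveGrading {
  weight_zero : forall n, W n 0;
  weight_closed : forall n (c : k) (a b : A), W n a -> W n b ->
    W n (c *: a + b);
  weight_positive : forall a, W 0%N a -> a = 0;
  weight_span : forall a : A, exists (N : nat) (x : nat -> A),
    (forall n, W n (x n)) /\ a = \sum_(n < N) x n;
  weight_direct : forall (N : nat) (x : nat -> A), (forall n, W n (x n)) ->
    \sum_(n < N) x n = 0 -> forall n, (n < N)%N -> x n = 0
}.

Record graded_algebra (k : fieldType) (P : presentation k) : Type := GradedAlgebra {
  graded_alg :> algebra P;
  weight : nat -> graded_alg -> Prop;
  weightP : positive_grading weight;
  weight_op : forall (w : gen P) (i j : nat) (a b : graded_alg),
    weight i a -> weight j b -> weight (i + j)%N (alg_op w a b)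
}.
Arguments weight {k P} _ _ _.

Record graded_hom (k : fieldType) (P : presentation k) (A B : graded_algebra P) :
    Type := GradedHom {
  graded_hom_alg :> alg_hom A B;
  hom_weight : forall (n : nat) (a : A),
    weight A n a -> weight B n (graded_hom_alg a)
}.

(** * Categories and functors *)

Record category : Type := Category {
  obj :> Type;
  hom : obj -> obj -> Type;
  idh : forall X, hom X X;
  comph : forall X Y Z, hom Y Z -> hom X Y -> hom X Z;
  comph_idl : forall X Y (f : hom X Y), comph (idh Y) f = f;
  comph_idr : forall X Y (f : hom X Y), comph f (idh X) = f;
  comphA : forall X Y Z T (h : hom Z T) (g : hom Y Z) (f : hom X Y),
    comph h (comph g f) = comph (comph h g) f
}.
Arguments hom {_} _ _.
Arguments idh {_} _.
Arguments comph {_ _ _ _} _ _.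

Definition is_functor (C D : category) (F : C -> D)
    (Fh : forall X Y : C, hom X Y -> hom (F X) (F Y)) : Prop :=
  (forall X : C, Fh X X (idh X) = idh (F X)) /\
  (forall (X Y Z : C) (g : hom Y Z) (f : hom X Y),
     Fh X Z (comph g f) = comph (Fh Y Z g) (Fh X Y f)).

Section Categories.
Variables (k : fieldType) (P : presentation k).

Lemma alg_hom_eq (A B : algebra P) (f g : alg_hom A B) :
  hom_fun f = hom_fun g -> f = g.
Proof.
case: f g => [f fl fo] [g gl go] /= e; case: g / e gl go => gl go.
by rewrite (proof_irrelevance _ gl fl) (proof_irrelevance _ go fo).
Qed.

Lemma graded_hom_eq (A B : graded_algebra P) (f g : graded_hom A B) :
  hom_fun f = hom_fun g -> f = g.
Proof.
case: f g => [f fw] [g gw] /= /alg_hom_eq e; case: g / e gw => gw.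
by rewrite (proof_irrelevance _ gw fw).
Qed.

Definition alg_id (A : algebra P) : alg_hom A A :=
  @AlgHom k P A A id (fun _ _ _ => erefl) (fun _ _ _ => erefl).

Lemma alg_comp_linear (A B C : algebra P) (g : alg_hom B C)
  (f : alg_hom A B) : linear (g \o f).
Proof. by move=> c u v; rewrite /= !hom_linear. Qed.

Lemma alg_comp_op (A B C : algebra P) (g : alg_hom B C) (f : alg_hom A B)
  (w : gen P) (a b : A) :
  (g \o f) (alg_op w a b) = alg_op w ((g \o f) a) ((g \o f) b).
Proof. by rewrite /= !hom_op. Qed.

Definition alg_comp (A B C : algebra P) (g : alg_hom B C) (f : alg_hom A B) :
    alg_hom A C :=
  AlgHom (alg_comp_linear g f) (alg_comp_op g f).

Definition graded_id (A : graded_algebra P) : graded_hom A A :=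
  @GradedHom k P A A (alg_id A) (fun _ _ Wa => Wa).

Definition graded_comp (A B C : graded_algebra P) (g : graded_hom B C)
    (f : graded_hom A B) : graded_hom A C :=
  @GradedHom k P A C (alg_comp g f)
    (fun n a Wa => hom_weight g (hom_weight f Wa)).

Definition AlgCat : category.
Proof.
refine (@Category (algebra P) (@alg_hom k P) alg_id alg_comp _ _ _).
- by move=> A B f; exact: alg_hom_eq.
- by move=> A B f; exact: alg_hom_eq.
- by move=> A B C D h g f; exact: alg_hom_eq.
Defined.

Definition GradedAlgCat : category.
Proof.
refine (@Category (graded_algebra P) (@graded_hom k P)
          graded_id graded_comp _ _ _).
- by move=> A B f; exact: graded_hom_eq.
- by move=> A B f; exact: graded_hom_eq.
- by move=> A B C D h g f; exact: graded_hom_eq.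
Defined.

End Categories.

(* Main.v *)
Require Import Defs.
From mathcomp Require Import all_boot all_order all_algebra.
From Stdlib Require Import IndefiniteDescription.

Set Implicit Arguments.
Unset Strict Implicit.
Unset Printing Implicit Defensive.

Import GRing.Theory.
Local Open Scope ring_scope.

(** On homogeneous inputs a_i of weights d_i, the factors along the path from
    the root of a tree monomial t to the leaf x telescope, while those off the
    path add up to 1: evaluating Su_x(t) gives d_x / (d_1 + ... + d_n) times
    the value of t.  This scalar does not depend on t, so Su_x(r) vanishes
    whenever r does; multilinearity extends this to arbitrary inputs. *)

(** * Consequences of linearity for bare functions *)

Section Linear.
Variables (k : fieldType) (U V : lmodType k) (f : U -> V).
Hypothesis fL : linear f.

Lemma linear_map0 : f 0 = 0.
Proof.
(* At the scalar -1, linearity reads f 0 = - f 0 + f 0. *)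
have := fL (-1) 0 0; rewrite scaler0 addr0 => /eqP.
by rewrite scaleN1r addNr => /eqP.
Qed.

Lemma linear_mapZ c u : f (c *: u) = c *: f u.
Proof. by rewrite -[c *: u]addr0 fL linear_map0 addr0. Qed.

Lemma linear_mapD u v : f (u + v) = f u + f v.
Proof. by rewrite -[u in LHS]scale1r fL scale1r. Qed.

Lemma linear_map_sum (N : nat) (x : nat -> U) :
  f (\sum_(n < N) x n) = \sum_(n < N) f (x n).
Proof. exact: (big_morph f linear_mapD linear_map0). Qed.

End Linear.

Lemma sum_ord_widen (V : nmodType) (N M : nat) (x : nat -> V) :
  (N <= M)%N -> (forall n, (N <= n)%N -> x n = 0) ->
  \sum_(n < M) x n = \sum_(n < N) x n.
Proof.
move=> leNM x0; rewrite (big_ord_widen M x leNM) [RHS]big_mkcond /=.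
by apply: eq_bigr => n _; case: ltnP => // /x0.
Qed.

(** * Homogeneous components in a graded vector space *)

Section Components.
Variables (k : fieldType) (A : lmodType k) (W : nat -> A -> Prop).
Hypothesis hW : positive_grading W.

Lemma homogeneous_decomposition (a : A) :
  exists p : nat * (nat -> A),
    [/\ forall n, W n (p.2 n), forall n, (p.1 <= n)%N -> p.2 n = 0
      & a = \sum_(n < p.1) p.2 n].
Proof.
have [N [x [Wx ->]]] := weight_span hW a.
(* The terms of [x] from [N] on are arbitrary; cutting them to 0 lets the range of summation grow
   freely. *)
exists (N, fun n => if (n < N)%N then x n else 0) => /=; split.
- by move=> n; case: ifP => // _; exact: weight_zero hW n.
- by move=> n; case: ltnP.
- by apply: eq_bigr => n _; rewrite ltn_ord.
Qed.

(** Choice turns decompositions into a function of [a]. The components do not depend on the choice,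
    by [component_unique]; [degree_bound] is just some bound, not the least one. *)
Definition decomposition (a : A) :=
  proj1_sig (constructive_indefinite_description _
    (homogeneous_decomposition a)).

Definition degree_bound (a : A) : nat := (decomposition a).1.
Definition component (a : A) : nat -> A := (decomposition a).2.

Lemma decompositionP (a : A) :
  [/\ forall n, W n (component a n),
      forall n, (degree_bound a <= n)%N -> component a n = 0
    & a = \sum_(n < degree_bound a) component a n].
Proof.
exact: (proj2_sig (constructive_indefinite_description _
  (homogeneous_decomposition a))).
Qed.

Lemma weight_component a n : W n (component a n).
Proof. by have [] := decompositionP a. Qed.

Lemma component_eq0 a n : (degree_bound a <= n)%N -> component a n = 0.
Proof. by have [_ + _] := decompositionP a; apply. Qed.

Lemma sum_component a N : (degree_bound a <= N)%N ->
  \sum_(n < N) component a n = a.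
Proof.
move=> leN; rewrite (sum_ord_widen leN); first by have [] := decompositionP a.
exact: component_eq0.
Qed.

(** The difference of two decompositions of [a] is a homogeneous decomposition of 0, so directness
    kills each of its terms. *)
Lemma component_unique (a : A) (N : nat) (x : nat -> A) :
  (forall n, W n (x n)) -> (forall n, (N <= n)%N -> x n = 0) ->
  a = \sum_(n < N) x n -> component a =1 x.
Proof.
(* [M] covers both decompositions and also exceeds [n], as directness only speaks of indices inside
   the range. *)
move=> Wx x0 aE n; pose M := maxn (maxn N (degree_bound a)) n.+1.
have leN : (N <= M)%N by rewrite /M -maxnA leq_maxl.
have ledeg : (degree_bound a <= M)%N by apply: leq_trans (leq_maxr N _) (leq_maxl _ _).
pose y m := -1 *: x m + component a m.
have Wy m : W m (y m).
  by apply: (weight_closed hW) => //; exact: weight_component.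
have y0 : \sum_(m < M) y m = 0.
  rewrite /y big_split -scaler_sumr /= (sum_ord_widen leN x0) -aE.
  by rewrite sum_component // scaleN1r addNr.
have := weight_direct hW Wy y0 (leq_maxr _ _ : n < M)%N.
by rewrite /y scaleN1r addrC => /eqP; rewrite subr_eq0 => /eqP.
Qed.

Lemma component_homogeneous a m : W m a ->
  component a =1 fun n => if n == m then a else 0.
Proof.
move=> Wa; apply: (@component_unique _ m.+1) => [n|n|].
- by case: eqP => [->//|_]; exact: weight_zero hW n.
- by case: eqP => // ->; rewrite ltnn.
- rewrite big_ord_recr /= eqxx big1 ?add0r // => i _.
  by rewrite ltn_eqF.
Qed.

Lemma component_linear n : linear (component^~ n).
Proof.
move=> c a b; pose N := maxn (degree_bound a) (degree_bound b).
apply: (@component_unique _ N (fun n => c *: component a n + component b n)).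
- move=> m; apply: (weight_closed hW); exact: weight_component.
- move=> m; rewrite geq_max => /andP[lea leb].
  by rewrite !component_eq0 // scaler0 addr0.
- rewrite big_split -scaler_sumr /= !sum_component //.
  + exact: leq_maxr.
  + exact: leq_maxl.
Qed.

(* The component of weight 0 vanishes, so it also has weight 1. *)
Lemma component_positive a n : exists m, W m.+1 (component a n).
Proof.
case: n => [|n]; last by exists n; exact: weight_component.
exists 0%N; rewrite (weight_positive hW (weight_component a 0)).
exact: weight_zero hW 1%N.
Qed.

(** * Rescaling a bilinear operation by weights *)

Section Twist.
Variables (phi : nat -> nat -> k) (beta : A -> A -> A).
Hypothesis beta_linear_l : forall b, linear (beta^~ b).
Hypothesis beta_linear_r : forall a, linear (beta a).

(** The shares are prescribed on homogeneous elements only; this is the bilinear extension of the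
    rescaled operation to all of [A]. *)
Definition twist (a b : A) : A :=
  \sum_(i < degree_bound a) \sum_(j < degree_bound b)
    phi i j *: beta (component a i) (component b j).

(** Frees the ranges from the inputs, so that values of [twist] at different inputs can be compared
    term by term. *)
Lemma twistE N M a b : (degree_bound a <= N)%N -> (degree_bound b <= M)%N ->
  twist a b = \sum_(i < N) \sum_(j < M)
    phi i j *: beta (component a i) (component b j).
Proof.
pose F i j := phi i j *: beta (component a i) (component b j); move=> leN leM.
rewrite (sum_ord_widen (x := fun i => \sum_(j < M) F i j) leN); last first.
  move=> i lei; rewrite big1 // => j _.
  by rewrite /F (component_eq0 lei) (linear_map0 (beta_linear_l _)) scaler0.
apply: eq_bigr => i _.
rewrite (sum_ord_widen (x := F i) leM) // => j lej.
by rewrite /F (component_eq0 lej) (linear_map0 (beta_linear_r _)) scaler0.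
Qed.

Lemma twist_linear_l b : linear (twist^~ b).
Proof.
move=> c u v; pose N := maxn (maxn (degree_bound u) (degree_bound v))
  (degree_bound (c *: u + v)).
rewrite !(@twistE N (degree_bound b)) ?leqnn ?leq_maxr //; first last.
- by rewrite /N -maxnA leq_maxl.
- exact: leq_trans (leq_maxr (degree_bound u) _) (leq_maxl _ _).
rewrite scaler_sumr -big_split; apply: eq_bigr => i _ /=.
rewrite scaler_sumr -big_split; apply: eq_bigr => j _ /=.
by rewrite component_linear beta_linear_l scalerDr !scalerA mulrC.
Qed.

Lemma twist_linear_r a : linear (twist a).
Proof.
move=> c u v; pose N := maxn (maxn (degree_bound u) (degree_bound v))
  (degree_bound (c *: u + v)).
rewrite !(@twistE (degree_bound a) N) ?leqnn ?leq_maxr //; first last.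
- by rewrite /N -maxnA leq_maxl.
- exact: leq_trans (leq_maxr (degree_bound u) _) (leq_maxl _ _).
rewrite scaler_sumr -big_split; apply: eq_bigr => i _ /=.
rewrite scaler_sumr -big_split; apply: eq_bigr => j _ /=.
by rewrite component_linear beta_linear_r scalerDr !scalerA mulrC.
Qed.

Lemma twist_homogeneous i j a b : W i a -> W j b ->
  twist a b = phi i j *: beta a b.
Proof.
move=> Wa Wb.
(* The bounds may fail to exceed [i] or [j] when [a] or [b] is 0; once enlarged, the ranges contain
   the only surviving pair of indices. *)
pose N := maxn (degree_bound a) i.+1; pose M := maxn (degree_bound b) j.+1.
rewrite (@twistE N M) ?leq_maxl //.
rewrite (bigD1 (Ordinal (leq_maxr _ _ : i < N)%N)) //= [X in _ + X]big1.
  rewrite addr0 (bigD1 (Ordinal (leq_maxr _ _ : j < M)%N)) //= big1.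
    by rewrite addr0 !(component_homogeneous Wa, component_homogeneous Wb) !eqxx.
  move=> m; rewrite -val_eqE /= => /negbTE nm.
  rewrite (component_homogeneous Wb) nm.
  by rewrite (linear_map0 (beta_linear_r _)) scaler0.
move=> m; rewrite -val_eqE /= => /negbTE nm; rewrite big1 // => l _.
rewrite (component_homogeneous Wa) nm.
by rewrite (linear_map0 (beta_linear_l _)) scaler0.
Qed.

End Twist.

Lemma twist_linear_op (X : lmodType k) (phi : nat -> nat -> k)
    (beta : X -> A -> A -> A) (a b : A) :
  (forall a b, linear (fun w => beta w a b)) ->
  linear (fun w => twist phi (beta w) a b).
Proof.
move=> betaL c u v; rewrite scaler_sumr -big_split; apply: eq_bigr => i _ /=.
rewrite scaler_sumr -big_split; apply: eq_bigr => j _ /=.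
by rewrite betaL scalerDr !scalerA mulrC.
Qed.

Lemma twist_flip phi beta a b :
  twist phi beta a b =
  twist (fun i j => phi j i) (fun a b => beta b a) b a.
Proof. by rewrite /twist exchange_big. Qed.

End Components.

(** * Multilinearity of tree evaluation *)

Section TreeEvaluation.
Variables (k : fieldType) (V : Type) (I : eqType) (A : lmodType k).
Variable op : V -> A -> A -> A.
Hypothesis op_l : forall w b, linear (fun a => op w a b).
Hypothesis op_r : forall w a, linear (op w a).

Definition update (a : I -> A) (i : I) (z : A) : I -> A :=
  fun j => if j == i then z else a j.

Lemma eq_eval_tree (a b : I -> A) (t : tree V I) :
  {in leaves t, a =1 b} -> eval_tree op a t = eval_tree op b t.
Proof.
elim: t => [i|w l IHl r IHr] /= eab; first by apply: eab; rewrite inE.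
by rewrite IHl ?IHr // => i ti; apply: eab; rewrite mem_cat ti ?orbT.
Qed.

Lemma eval_tree_update_out a i z (t : tree V I) : i \notin leaves t ->
  eval_tree op (update a i z) t = eval_tree op a t.
Proof.
move=> it; apply: eq_eval_tree => j jt; rewrite /update.
by case: eqP => // ji; rewrite -ji jt in it.
Qed.

(** Since the leaves are distinct, [i] lies in exactly one subtree at each vertex of its path, so
    [z] enters through one argument only. *)
Lemma eval_tree_linear a i (t : tree V I) :
  uniq (leaves t) -> i \in leaves t ->
  linear (fun z => eval_tree op (update a i z) t).
Proof.
elim: t => [j|w l IHl r IHr] /=.
  by rewrite inE => _ /eqP-> c u v; rewrite /update eqxx.
rewrite cat_uniq => /and3P[ul dlr ur]; rewrite mem_cat.
case: (boolP (i \in leaves l)) => [il _|il /= ir] c u v.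
  have ir : i \notin leaves r.
    by apply: contra dlr => ir; apply/hasP; exists i.
  by rewrite !(eval_tree_update_out _ _ ir) IHl // op_l.
by rewrite !(eval_tree_update_out _ _ il) IHr // op_r.
Qed.

End TreeEvaluation.

Lemma tree_monomial_uniq (V : Type) n (t : tree V 'I_n) :
  tree_monomial t -> uniq (leaves t).
Proof. by move=> /perm_uniq->; exact: enum_uniq. Qed.

Lemma mem_tree_monomial (V : Type) n (t : tree V 'I_n) i :
  tree_monomial t -> i \in leaves t.
Proof. by move=> /perm_mem->; rewrite mem_enum. Qed.

(** * Reduction of identities to homogeneous inputs *)

Section Multilinear.
Variables (k : fieldType) (V : Type) (A : lmodType k).
Variable op : V -> A -> A -> A.
Hypothesis op_l : forall w b, linear (fun a => op w a b).
Hypothesis op_r : forall w a, linear (op w a).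

Lemma eq_eval_sum n (a b : 'I_n -> A) (r : tree_sum k V n) :
  a =1 b -> eval_sum op a r = eval_sum op b r.
Proof.
by move=> ab; apply: eq_bigr => ct _; congr (_ *: _); apply: eq_eval_tree.
Qed.

Lemma eval_sum_linear n (a : 'I_n -> A) i (r : tree_sum k V n) :
  all (fun ct => tree_monomial ct.2) r ->
  linear (fun z => eval_sum op (update a i z) r).
Proof.
move=> rM c u v; rewrite /eval_sum; elim: r rM => [|ct r IH] /=.
  by rewrite !big_nil scaler0 addr0.
move=> /andP[tM rM]; rewrite !big_cons IH //.
rewrite (eval_tree_linear op_l op_r) ?tree_monomial_uniq ?mem_tree_monomial //.
by rewrite !scalerDr !scalerA (mulrC ct.1) addrACA.
Qed.

Lemma eval_sum_eq0 (W : nat -> A -> Prop) (hW : positive_grading W) n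
    (r : tree_sum k V n) :
  all (fun ct => tree_monomial ct.2) r ->
  (forall (a : 'I_n -> A) (d : 'I_n -> nat),
     (forall i, W (d i).+1 (a i)) -> eval_sum op a r = 0) ->
  forall a : 'I_n -> A, eval_sum op a r = 0.
Proof.
move=> rM r0 a.
(* Induction on the list [s] of positions where the input may still be inhomogeneous; each step
   expands one input into its components. *)
suff IH (s : seq 'I_n) b :
    (forall i, i \notin s -> exists m, W m.+1 (b i)) -> eval_sum op b r = 0.
  by apply: (IH (enum 'I_n)) => i; rewrite mem_enum.
elim: s b => [|i s IH] b hb.
  pose d i := proj1_sig (constructive_indefinite_description _ (hb i isT)).
  apply: (r0 b d) => i.
  exact: (proj2_sig (constructive_indefinite_description _ (hb i isT))).
rewrite (@eq_eval_sum _ _ (update b i (b i))); last first.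
  by move=> j; rewrite /update; case: eqP => // ->.
rewrite -[X in update b i X](sum_component (leqnn (degree_bound hW (b i)))).
rewrite (linear_map_sum (eval_sum_linear b i rM)) big1 // => m _.
apply: IH => j js; rewrite /update; case: eqP => [_|/eqP ji].
  exact: component_positive.
by apply: hb; rewrite inE negb_or ji.
Qed.

End Multilinear.

(** Characteristic zero enters here: positive weights are invertible in [k]. *)
Lemma natf_neq0_pchar0 (k : fieldType) (hk : [pchar k] =i pred0) m :
  (0 < m)%N -> m%:R != 0 :> k.
Proof. by move: hk => /pcharf0P->; rewrite -lt0n. Qed.

(** * The operations of the disuccessor on a graded algebra *)

Section Disuccession.
Variables (k : fieldType) (hk : [pchar k] =i pred0) (P : presentation k).
Variable A : graded_algebra P.

(** At i = j = 0 division by zero gives the value 0; this is harmless because only the zero vector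
    has weight 0. *)
Definition left_share (i j : nat) : k := i%:R / (i + j)%:R.
Definition right_share (i j : nat) : k := j%:R / (i + j)%:R.

Definition dsu_op (w : gen (DSu P)) (a b : A) : A :=
  twist (weightP A) left_share (alg_op w.1) a b +
  twist (weightP A) right_share (alg_op w.2) a b.

Let opL (w : gen P) (b : A) := op_linear_l (algP A) w b.
Let opR (w : gen P) (a : A) := op_linear_r (algP A) w a.

Lemma dsu_op_homogeneous (w : gen (DSu P)) i j a b :
  weight A i a -> weight A j b ->
  dsu_op w a b = left_share i j *: alg_op w.1 a b +
                 right_share i j *: alg_op w.2 a b.
Proof. by move=> Wa Wb; rewrite /dsu_op !(twist_homogeneous _ _ _ _ Wa Wb). Qed.

Lemma alg_op0 (a b : A) : alg_op 0 a b = 0.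
Proof. exact: (linear_map0 (op_linear_gen (algP A) a b)). Qed.

Lemma dsu_op_prec w i j a b : weight A i a -> weight A j b ->
  dsu_op (prec w) a b = left_share i j *: alg_op w a b.
Proof.
by move=> Wa Wb; rewrite (dsu_op_homogeneous _ Wa Wb) alg_op0 scaler0 addr0.
Qed.

Lemma dsu_op_succ w i j a b : weight A i a -> weight A j b ->
  dsu_op (succ w) a b = right_share i j *: alg_op w a b.
Proof.
by move=> Wa Wb; rewrite (dsu_op_homogeneous _ Wa Wb) alg_op0 scaler0 add0r.
Qed.

Lemma dsu_op_sum w i j a b : (0 < i)%N -> weight A i a -> weight A j b ->
  dsu_op (prec w + succ w) a b = alg_op w a b.
Proof.
move=> i0 Wa Wb; rewrite (dsu_op_homogeneous _ Wa Wb) /= addr0 add0r.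
rewrite -scalerDl -mulrDl -natrD divff ?scale1r //.
by rewrite natf_neq0_pchar0 // addn_gt0 i0.
Qed.

Lemma dsu_op_linear_l w b : linear (fun a => dsu_op w a b).
Proof.
move=> c u v; rewrite /dsu_op !twist_linear_l //.
by rewrite scalerDr addrACA.
Qed.

Lemma dsu_op_linear_r w a : linear (dsu_op w a).
Proof.
move=> c u v; rewrite /dsu_op !twist_linear_r //.
by rewrite scalerDr addrACA.
Qed.

Lemma dsu_op_linear_gen a b : linear (fun w => dsu_op w a b).
Proof.
move=> c u v; rewrite /dsu_op /=.
rewrite !(@twist_linear_op _ _ _ _ _ _ (@alg_op k P A)) //;
  try exact: op_linear_gen (algP A).
by rewrite scalerDr addrACA.
Qed.

(** The action exchanges the two halves of the generator, and exchanging the inputs turns each share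
    into the other. *)
Lemma dsu_op_swap (w : gen (DSu P)) a b : dsu_op (swap w) a b = dsu_op w b a.
Proof.
rewrite /dsu_op [swap w]dsu_swapE /= addrC; congr (_ + _);
  rewrite [RHS]twist_flip /twist;
  apply: eq_bigr => i _; apply: eq_bigr => j _;
  by rewrite (op_swap (algP A)) /left_share /right_share addnC.
Qed.

(** * Evaluation of Su_x on homogeneous inputs *)

Section Homogeneous.
Variables (n : nat) (a : 'I_n -> A) (d : 'I_n -> nat).
Hypothesis Wa : forall i, weight A (d i) (a i).
Hypothesis d_gt0 : forall i, (0 < d i)%N.

Definition tree_weight (V : Type) (t : tree V 'I_n) : nat :=
  \sum_(i <- leaves t) d i.

Lemma tree_weight_gt0 (V : Type) (t : tree V 'I_n) : (0 < tree_weight t)%N.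
Proof.
rewrite /tree_weight; elim: t => [i|w l IHl r _] /=; first by rewrite big_seq1.
by rewrite big_cat addn_gt0 IHl.
Qed.

Lemma weight_eval_tree (t : tree (gen P) 'I_n) :
  weight A (tree_weight t) (eval_tree (@alg_op _ _ A) a t).
Proof.
rewrite /tree_weight; elim: t => [i|w l IHl r IHr] /=; first by rewrite big_seq1.
by rewrite big_cat; exact: weight_op.
Qed.

Lemma eval_Su x (t : tree (gen P) 'I_n) : uniq (leaves t) ->
  eval_tree dsu_op a (Su x t) =
  (if x \in leaves t then (d x)%:R / (tree_weight t)%:R else 1) *:
    eval_tree (@alg_op _ _ A) a t.
Proof.
have nz (t' : tree (gen P) 'I_n) : (tree_weight t')%:R != 0 :> k.
  by rewrite natf_neq0_pchar0 // tree_weight_gt0.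
elim: t => [i|w l IHl r IHr] /=.
  move=> _; rewrite /tree_weight /= inE big_seq1.
  case: eqP => [->|_]; last by rewrite scale1r.
  by rewrite divff ?scale1r // natf_neq0_pchar0.
rewrite cat_uniq mem_cat => /and3P[ul dlr ur].
rewrite {}IHl // {}IHr //.
have wN : tree_weight (Node w l r) = (tree_weight l + tree_weight r)%N.
  by rewrite /tree_weight /= big_cat.
have Wl := weight_eval_tree l; have Wr := weight_eval_tree r.
case: (boolP (x \in leaves l)) => [xl|xl] /=.
  have /negbTE-> : x \notin leaves r.
    by apply: contra dlr => xr; apply/hasP; exists x.
  (* The numerator of the left share is the weight of [l], which cancels the denominator supplied by
     induction; the branch [r] is off the path and contributes 1. *)
  rewrite (linear_mapZ (dsu_op_linear_l _ _)) scale1r (dsu_op_prec w Wl Wr).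
  by rewrite scalerA /left_share -wN mulrA divfK.
case: (boolP (x \in leaves r)) => [xr|xr] /=.
  rewrite (linear_mapZ (dsu_op_linear_r _ _)) scale1r (dsu_op_succ w Wl Wr).
  by rewrite scalerA /right_share -wN mulrA divfK.
by rewrite !scale1r (dsu_op_sum w (tree_weight_gt0 l) Wl Wr).
Qed.

(** Each leaf occurs once in a tree monomial, so all the trees have the same total weight and the
    scalar factors out of the sum. *)
Lemma eval_Su_sum x (r : tree_sum k (gen P) n) :
  all (fun ct => tree_monomial ct.2) r ->
  eval_sum dsu_op a (Su_sum x r) =
  ((d x)%:R / (\sum_i d i)%:R) *: eval_sum (@alg_op _ _ A) a r.
Proof.
rewrite /eval_sum big_map scaler_sumr; elim: r => [|ct r IH] /=.
  by rewrite !big_nil.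
move=> /andP[tM rM]; rewrite !big_cons IH //=; congr (_ + _).
rewrite eval_Su ?tree_monomial_uniq // mem_tree_monomial //.
rewrite !scalerA mulrC; congr ((_ / _%:R * _) *: _).
by rewrite /tree_weight (perm_big _ tM) big_enum.
Qed.

End Homogeneous.

Lemma dsu_op_is_algebra : is_algebra dsu_op.
Proof.
split.
- exact: dsu_op_linear_gen.
- exact: dsu_op_linear_l.
- exact: dsu_op_linear_r.
- exact: dsu_op_swap.
- move=> n s sP; apply: (eval_sum_eq0 dsu_op_linear_l dsu_op_linear_r (weightP A)).
    exact: rel_monomial sP.
  move=> a d Wa; case: sP => r [x [rP ->]].
  rewrite (@eval_Su_sum _ _ (fun i => (d i).+1)) //; last exact: rel_monomial rP.
  by rewrite (op_rel (algP A) rP) scaler0.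
Qed.

End Disuccession.

(** * Compatibility with graded morphisms *)

Section Functoriality.
Variables (k : fieldType) (P : presentation k) (A B : graded_algebra P).
Variable f : graded_hom A B.

(** The images of the components of [a] form a homogeneous decomposition of [f a], and
    decompositions are unique. *)
Lemma component_hom a n :
  component (weightP B) (f a) n = f (component (weightP A) a n).
Proof.
have fL := hom_linear f.
apply: (@component_unique _ _ _ (weightP B) _ (degree_bound (weightP A) a)
         (fun n => f (component (weightP A) a n))).
- by move=> m; apply: hom_weight; exact: weight_component.
- by move=> m lem; rewrite component_eq0 // (linear_map0 fL).
- by rewrite -(linear_map_sum fL) sum_component.
Qed.

Lemma twist_hom phi w (a b : A) :
  f (twist (weightP A) phi (alg_op w) a b) =
  twist (weightP B) phi (alg_op w) (f a) (f b).
Proof.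
have fL := hom_linear f.
have opL v c := op_linear_l (algP B) v c.
have opR v c := op_linear_r (algP B) v c.
(* The bounds of [a] and [f a] come from unrelated choices, hence the common ranges [N] and [M]. *)
pose N := maxn (degree_bound (weightP A) a) (degree_bound (weightP B) (f a)).
pose M := maxn (degree_bound (weightP A) b) (degree_bound (weightP B) (f b)).
rewrite (@twistE _ _ _ (weightP B) phi _ (opL w) (opR w) N M) ?leq_maxr //.
rewrite (@twistE _ _ _ (weightP A) phi _ (op_linear_l (algP A) w)
  (op_linear_r (algP A) w) N M) ?leq_maxl //.
pose F i j :=
  phi i j *: alg_op w (component (weightP A) a i) (component (weightP A) b j).
rewrite (linear_map_sum fL N (fun i => \sum_(j < M) F i j)).
apply: eq_bigr => i _; rewrite (linear_map_sum fL M (F i)).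
apply: eq_bigr => j _.
by rewrite (linear_mapZ fL) hom_op !component_hom.
Qed.

Lemma dsu_op_hom (w : gen (DSu P)) (a b : A) :
  f (dsu_op w a b) = dsu_op w (f a) (f b).
Proof. by rewrite /dsu_op (linear_mapD (hom_linear f)) !twist_hom. Qed.

End Functoriality.

Theorem proposition2p6 (k : fieldType) (hk : [pchar k] =i pred0)
    (P : presentation k) :
  exists op : forall A : graded_algebra P, gen (DSu P) -> A -> A -> A,
    (forall (A : graded_algebra P) (w : gen P) (i j : nat) (a1 a2 : A),
       weight A i a1 -> weight A j a2 ->
       op A (prec w) a1 a2 = (i%:R / (i + j)%:R) *: alg_op w a1 a2 /\
       op A (succ w) a1 a2 = (j%:R / (i + j)%:R) *: alg_op w a1 a2) /\
    exists (opP : forall A : graded_algebra P, is_algebra (op A))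
      (homP : forall (A B : graded_algebra P) (f : graded_hom A B)
         (w : gen (DSu P)) (a1 a2 : A),
         f (op A w a1 a2) = op B w (f a1) (f a2)),
      @is_functor (GradedAlgCat P) (AlgCat (DSu P))
        (fun A => Algebra (opP A))
        (fun A B f =>
           @AlgHom k (DSu P) (Algebra (opP A)) (Algebra (opP B))
             (hom_fun f) (hom_linear f) (homP A B f)).
Proof.
exists (@dsu_op k P); split.
  move=> A w i j a b Wa Wb; split.
    exact: dsu_op_prec.
  exact: dsu_op_succ.
exists (@dsu_op_is_algebra k hk P), (@dsu_op_hom k P).
(* The functor keeps underlying maps, and morphisms with the same underlying map are equal. *)
by split=> *; exact: alg_hom_eq.
Qed.
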